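(* Let $p$, $L$, $\mathbf L$, $W_{\mathrm G}$, $\mathrm G$, $\mathbf W_{\mathrm D}$, $\mathrm D$, $V$ and the (semi-)norms $\|\cdot\|_{W_{\mathrm G},\mathcal G}$, $\|\cdot\|_{W_{\mathrm G}}$ be as in the context. Then $$L'=\mathrm{Im}(\mathrm D)+V$$ if and only if $\|\cdot\|_{W_{\mathrm G}}$ and $\|\cdot\|_{W_{\mathrm G},\mathcal G}$ are two equivalent norms on $W_{\mathrm G}$ (that is, there exists $C>0$ such that $\|u\|_{W_{\mathrm G},\mathcal G}\le C\|u\|_{W_{\mathrm G}}$ for all $u\in W_{\mathrm G}$).
   Context: All vector spaces are real. Let $p\in(1,+\infty)$ and $p'$ with $1/p+1/p'=1$. Let $L$ and $\mathbf L$ be separable reflexive Banach spaces with topological duals $L'$ and $\mathbf L'$. Let $W_{\mathrm G}\subset L$ be a dense linear subspace of $L$ and let $\mathrm G:W_{\mathrm G}\to\mathbf L$ be a linear operator whose graph is closed in $L\times\mathbf L$. The graph norm on $W_{\mathrm G}$ is $\|u\|_{W_{\mathrm G},\mathcal G}=(\|u\|_L^p+\|\mathrm Gu\|_{\mathbf L}^p)^{1/p}$. Define $\mathbf W_{\mathrm D}=\{\mathbf v\in\mathbf L' : \exists w\in L',\ \forall u\in W_{\mathrm G},\ \langle\mathbf v,\mathrm Gu\rangle_{\mathbf L',\mathbf L}+\langle w,u\rangle_{L',L}=0\}$. By density of $W_{\mathrm G}$ in $L$, the element $w$ is unique for each $\mathbf v\in\mathbf W_{\mathrm D}$; set $\mathrm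 D\mathbf v:=w$, which defines a linear operator $\mathrm D:\mathbf W_{\mathrm D}\to L'$, with range $\mathrm{Im}(\mathrm D)=\mathrm D(\mathbf W_{\mathrm D})$. Let $V$ be a closed subspace of $L'$. For $u\in L$ put $|u|_{L,V}=\sup_{\mu\in V\setminus\{0\}}\frac{|\langle\mu,u\rangle_{L',L}|}{\|\mu\|_{L'}}$ if $V\neq\{0\}$ and $|u|_{L,V}=0$ if $V=\{0\}$. For $u\in W_{\mathrm G}$ put $\|u\|_{W_{\mathrm G}}=(|u|_{L,V}^p+\|\mathrm Gu\|_{\mathbf L}^p)^{1/p}$. (One always has $\|u\|_{W_{\mathrm G}}\le\|u\|_{W_{\mathrm G},\mathcal G}$.) *)

(* Defs.v *)
From HB Require Import structures.
From mathcomp Require Import all_boot all_order all_algebra.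
From mathcomp Require Import all_classical all_reals all_analysis.

Set Implicit Arguments.
Unset Strict Implicit.
Unset Printing Implicit Defensive.

Import Order.TTheory GRing.Theory Num.Theory.
Import numFieldNormedType.Exports.

Local Open Scope classical_set_scope.
Local Open Scope ring_scope.

Section dual_type.
Context {R : realType} (E : normedModType R).

Definition dual_pred : {pred E -> R^o} :=
  mem [set f : E -> R^o | linear f /\ continuous f].

Record dual : Type := Dual {
  dual_fun :> E -> R^o ;
  dual_funP : dual_fun \in dual_pred }.

HB.instance Definition _ := [isSub for dual_fun].
HB.instance Definition _ := [Choice of dual by <:].

Lemma dual_submod_closed : submod_closed dual_pred.
Proof.
split.
  rewrite inE; split; first by move=> a x y; rewrite scaler0 addr0.
  by move=> x; exact: cst_continuous.
move=> a f g; rewrite !inE => -[lf cf] [lg cg]; split=> [b x y|x].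
  rewrite -[LHS]/(a *: f (b *: x + y) + g (b *: x + y)) lf lg.
  rewrite -[RHS]/(b *: (a *: f x + g x) + (a *: f y + g y)).
  by rewrite !scalerDr !scalerA (mulrC a b) addrACA.
apply: (@continuousD _ _ _ (fun x => a *: f x) g); last exact: cg.
by apply: (@continuousZl_tmp _ _ _ f a); exact: cf.
Qed.

HB.instance Definition _ :=
  GRing.isSubmodClosed.Build _ _ dual_pred dual_submod_closed.
HB.instance Definition _ := [SubChoice_isSubLmodule of dual by <:].

Lemma dual_linear (f : dual) : linear (f : E -> R^o).
Proof. by have := dual_funP f; rewrite inE => -[]. Qed.

Lemma dual_continuous (f : dual) : continuous (f : E -> R^o).
Proof. by have := dual_funP f; rewrite inE => -[]. Qed.

HB.instance Definition _ (f : dual) :=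
  GRing.isLinear.Build R E R^o _ (dual_fun f) (dual_linear f).

Definition dual_norm (f : dual) : R :=
  sup [set `|f x| | x in [set x : E | `|x| <= 1]].

Lemma dual_norm_has_sup (f : dual) :
  has_sup [set `|f x| | x in [set x : E | `|x| <= 1]].
Proof.
split; first by exists `|f 0|; exists 0 => //=; rewrite normr0.
have /linear_boundedP : bounded_near f (nbhs (0 : E)).
  exact/linear_bounded_continuous/dual_continuous.
move=> /pinfty_ex_gt0 [r r0 rf]; exists r => _ [x /= x1 <-].
by rewrite (le_trans (rf x))// ler_piMr// ltW.
Qed.

Lemma dual_norm_ge0 f : 0 <= dual_norm f.
Proof.
have := sup_upper_bound (dual_norm_has_sup f) => /(_ `|f 0|).
by rewrite linear0 normr0; apply; exists 0; rewrite ?linear0 /= normr0.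
Qed.

Lemma dual_normP (f : dual) x : `|f x| <= dual_norm f * `|x|.
Proof.
have [->|x0] := eqVneq x 0; first by rewrite linear0 !normr0 mulr0.
have nx0 : 0 < `|x| by rewrite normr_gt0.
rewrite -ler_pdivrMr//; apply: (sup_upper_bound (dual_norm_has_sup f)).
exists (`|x|^-1 *: x) => /=.
  by rewrite normrZ normfV normr_id mulVf// gt_eqF.
by rewrite linearZ /= normrZ normfV normr_id mulrC.
Qed.

Lemma dual_norm_le (f : dual) c : (forall x, `|x| <= 1 -> `|f x| <= c) ->
  dual_norm f <= c.
Proof.
move=> fc; apply: ge_sup; first by case: (dual_norm_has_sup f).
by move=> _ [x /= x1 <-]; exact: fc.
Qed.

Lemma dual_normD f g : dual_norm (f + g) <= dual_norm f + dual_norm g.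
Proof.
apply: dual_norm_le => x x1; rewrite (le_trans (ler_normD _ _))// lerD//.
  by rewrite (le_trans (dual_normP f x))// ler_piMr// dual_norm_ge0.
by rewrite (le_trans (dual_normP g x))// ler_piMr// dual_norm_ge0.
Qed.

Let dual_normZ_le a f : dual_norm (a *: f) <= `|a| * dual_norm f.
Proof.
apply: dual_norm_le => x x1; rewrite [leLHS]normrZ ler_wpM2l//.
by rewrite (le_trans (dual_normP f x))// ler_piMr// dual_norm_ge0.
Qed.

Lemma dual_normZ a f : dual_norm (a *: f) = `|a| * dual_norm f.
Proof.
apply/eqP; rewrite eq_le dual_normZ_le /=.
have [->|a0] := eqVneq a 0; first by rewrite normr0 mul0r dual_norm_ge0.
rewrite -ler_pdivlMl ?normr_gt0// -normfV.
by have := dual_normZ_le a^-1 (a *: f); rewrite scalerA mulVf// scale1r.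
Qed.

Lemma dual_norm0_eq0 f : dual_norm f = 0 -> f = 0.
Proof.
move=> f0; apply/val_inj/funext => x; apply/eqP; rewrite -normr_le0.
by rewrite (le_trans (dual_normP f x))// f0 mul0r.
Qed.

HB.instance Definition _ := Lmodule_isNormed.Build R dual
  dual_normD dual_normZ dual_norm0_eq0.

Lemma dual_normE (f : dual) :
  `|f| = sup [set `|f x| | x in [set x : E | `|x| <= 1]].
Proof. by []. Qed.

End dual_type.

Definition separable (T : topologicalType) : Prop :=
  exists2 A : set T, countable A & dense A.

Definition reflexive_space (R : realType) (E : normedModType R) : Prop :=
  forall phi : dual (dual E), exists x : E, forall f : dual E, phi f = f x.

Section graph_operators.
Context {R : realType} (L LL : normedModType R).
(** The operator [G] is a total function of which only the values on [WG]
    are ever used. *)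
Variables (WG : set L) (G : L -> LL).

Definition linear_on : Prop :=
  forall (a : R) u v, WG u -> WG v -> G (a *: u + v) = a *: G u + G v.

Definition graph_on : set (L * LL) := [set z | WG z.1 /\ z.2 = G z.1].

(** The graph of the operator [D]. *)
Definition dual_rel (v : dual LL) (w : dual L) : Prop :=
  forall u, WG u -> v (G u) + w u = 0.

Definition WD : set (dual LL) := [set v | exists w : dual L, dual_rel v w].

(** By [dual_rel_uniq] there is nothing to choose from when [WG] is dense. *)
Definition Dop (v : dual LL) : dual L := xget 0 [set w | dual_rel v w].

Lemma dual_rel_Dop v : WD v -> dual_rel v (Dop v).
Proof. by move=> [w vw]; exact: (xgetI 0 vw). Qed.

Lemma dual_rel_uniq v w w' : dense WG -> dual_rel v w -> dual_rel v w' -> w = w'.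
Proof.
move=> dW vw vw'; apply/eqP/negPn/negP => /eqP ww'.
pose O := [set u : L | w u != w' u].
have oO : open O.
  rewrite (_ : O = (w - w') @^-1` [set~ 0]).
    apply: open_comp; first by move=> x _; exact: dual_continuous.
    by rewrite openC; exact: closed_eq.
  by apply/seteqP; split=> u /=; rewrite /O /= -subr_eq0 => /eqP.
have [|u [Ou Wu]] := dW O _ oO.
  apply: contra_notP ww' => /set0P/negP/negPn/eqP O0.
  apply/val_inj/funext => u; apply/eqP/negPn/negP => wu.
  by have : O u by []; rewrite O0.
by move/negP: Ou; apply; rewrite -(inj_eq (addrI (v (G u)))) vw// vw'.
Qed.

Definition ImD : set (dual L) := Dop @` WD.

(** Since [sup set0 = 0], this is [0] when [V = [set 0]]. *)
Definition seminorm_of (V : set (dual L)) (u : L) : R :=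
  sup [set `|mu u| / `|mu| | mu in V `\ 0].

Lemma seminorm_of_has_ubound V u :
  has_ubound [set `|mu u| / `|mu| | mu in V `\ (0 : dual L)].
Proof.
exists `|u| => _ [mu [_ /eqP mu0] <-].
by rewrite ler_pdivrMr ?normr_gt0// mulrC; exact: dual_normP.
Qed.

Lemma seminorm_of0 u : seminorm_of [set 0] u = 0.
Proof. by rewrite /seminorm_of setDv image_set0 sup0. Qed.

Definition normWG_graph (p : R) (u : L) : R :=
  (`|u| `^ p + `|G u| `^ p) `^ p^-1.

Definition normWG (p : R) (V : set (dual L)) (u : L) : R :=
  (seminorm_of V u `^ p + `|G u| `^ p) `^ p^-1.

End graph_operators.

(* Main.v *)
Require Import Defs.
From HB Require Import structures.
From mathcomp Require Import all_boot all_order all_algebra.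
From mathcomp Require Import all_classical all_reals all_analysis.
From mathcomp Require Import lra.

Set Implicit Arguments.
Unset Strict Implicit.
Unset Printing Implicit Defensive.

Import Order.TTheory GRing.Theory Num.Theory.
Import numFieldNormedType.Exports.

Local Open Scope classical_set_scope.
Local Open Scope ring_scope.

(** Both directions pass through an inequality free of the exponent [p]:
    coercivity, [`|u| <= K * (seminorm_of V u + `|G u|)] on [WG].  It is
    equivalent to the equivalence of the two norms because, on pairs of
    nonnegative numbers, the l^p norm lies between the maximum and twice the
    maximum ([normWG_equiv_coercive]).

    If every [f] in the dual of [L] splits as [D v + mu] with [mu] in [V], then
    [f u = - v (G u) + mu u], so [`|f u| <= `|v| + `|mu|] as soon as
    [seminorm_of V u + `|G u| <= 1].  The set of these [u] is thus weakly
    bounded; the uniform boundedness principle, applied on the dual of [L] (a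
    Banach space), makes it bounded, and this is coercivity by homogeneity
    ([coercive_of_range_sum]).

    Conversely, given [f], coercivity says that the functional
    [(u, G u) |-> f u] on the graph of [G] is dominated by a multiple of the
    seminorm [(x, y) |-> seminorm_of V x + `|y|] of [L * LL].  A Hahn-Banach
    extension has the form [(x, y) |-> mu x - v y], where [v] and [mu] are
    continuous and [`|mu x|] is bounded by a multiple of [seminorm_of V x].
    On the graph it equals [f], which reads [D v = f - mu].  Finally [mu]
    vanishes on the annihilator of [V] in [L]; as [L] is reflexive and [V] is
    closed, a Hahn-Banach separation in the dual of [L] shows that [mu] lies in
    [V] ([range_sum_of_coercive]). *)

(** * The Hahn-Banach theorem *)

Section hahn_banach.
Context {R : realType} (E : lmodType R) (q : E -> R).
Hypothesis qD : forall x y, q (x + y) <= q x + q y.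
Hypothesis qZ : forall a x, 0 <= a -> q (a *: x) = a * q x.

(** A functional defined on a subspace of [E] is represented by its graph, a
    subset of [E * R^o].  Domination by [q] alone makes such a linear relation
    single-valued, so that unions of chains of graphs need no gluing. *)
Definition lin_closed (A : set (E * R^o)) :=
  forall (a : R) u v, A u -> A v -> A (a *: u + v).

Definition dominated (A : set (E * R^o)) := forall z, A z -> z.2 <= q z.1.

Lemma lin_closed0 A z : lin_closed A -> A z -> A 0.
Proof. by move=> Al Az; have := Al (-1) _ _ Az Az; rewrite scaleN1r addNr. Qed.

Lemma lin_closedZ A a z : lin_closed A -> A z -> A (a *: z).
Proof.
by move=> Al Az; have := Al a _ _ Az (lin_closed0 Al Az); rewrite addr0.
Qed.

Lemma lin_closedD A y z : lin_closed A -> A y -> A z -> A (y + z).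
Proof. by move=> Al Ay Az; have := Al 1 _ _ Ay Az; rewrite scale1r. Qed.

(** The difference of two values at [x] is a value at [0], where [q] is [0]. *)
Lemma dominated_functional A x r s : lin_closed A -> dominated A ->
  A (x, r) -> A (x, s) -> r = s.
Proof.
move=> Al Aq Ar As.
have q0 : q 0 = 0 by rewrite -(scale0r 0) qZ// mul0r.
have le r' s' : A (x, r') -> A (x, s') -> s' <= r'.
  move=> Ar' As'; have /= := Aq _ (Al (-1) _ _ Ar' As').
  by rewrite !scaleN1r addNr q0 addrC subr_le0.
by apply/eqP; rewrite eq_le !le.
Qed.

(** The value [c] at [x0] has to satisfy
    [z.2 - q (z.1 - x0) <= c <= q (z'.1 + x0) - z'.2] for all [z] and [z'] in
    the graph, and subadditivity of [q] puts every lower bound below every upper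
    bound. *)
Lemma dominated_extension A x0 : lin_closed A -> dominated A -> A !=set0 ->
  exists c : R, dominated [set z | exists t : R, A (z - t *: (x0, c : R^o))].
Proof.
move=> Al Aq A0.
pose S := [set z.2 - q (z.1 - x0) | z in A].
have Sub z' : A z' -> ubound S (q (z'.1 + x0) - z'.2).
  move=> Az' _ [z Az <-].
  have /= := Aq _ (lin_closedD Al Az Az').
  have := qD (z.1 - x0) (z'.1 + x0).
  by rewrite addrACA addNr addr0; lra.
have hS : has_sup S.
  split; first by case: A0 => z Az; exists (z.2 - q (z.1 - x0)); exists z.
  by case: A0 => z Az; exists (q (z.1 + x0) - z.2); exact: Sub.
exists (sup S) => -[x r] /= [t]; set c := sup S => Az.
have [t0|t0|t0] := ltgtP t 0; last first.
- by have /= := Aq _ Az; rewrite t0 !scale0r !subr0.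
- have /= := ge_sup hS.1 (Sub _ (lin_closedZ t^-1 Al Az)); rewrite -/c => h.
  have /= : c * t <= t * (q (t^-1 *: (x - t *: x0) + x0) - t^-1 * (r - t * c)).
    by rewrite mulrC ler_pM2l.
  rewrite mulrBr -qZ ?(ltW t0)// scalerDr scalerA mulfV ?gt_eqF// scale1r subrK.
  by rewrite mulrA mulfV ?gt_eqF// mul1r; lra.
- have scE (a b : R) : a *: (b : R^o) = a * b by [].
  have s0 : 0 < - t by rewrite oppr_gt0.
  have /= := sup_upper_bound hS (imageP _ (lin_closedZ (- t)^-1 Al Az)).
  rewrite -/c -(ler_pM2l s0) mulrBr -qZ ?(ltW s0)//.
  rewrite [_ *: (_ - x0)]scalerBr !scalerA mulfV ?gt_eqF// scale1r scaleNr.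
  rewrite opprK subrK !scE mulrA mulfV ?gt_eqF// mul1r mulNr.
  by rewrite addrAC gerDr subr_le0.
Qed.

(** A maximal dominated graph that contains [A0] is defined everywhere, as
    otherwise [dominated_extension] would enlarge it. *)
Lemma hahn_banach (A0 : set (E * R^o)) : A0 !=set0 ->
  lin_closed A0 -> dominated A0 ->
  exists2 F : {linear E -> R^o},
    forall z, A0 z -> F z.1 = z.2 & forall x, F x <= q x.
Proof.
move=> A0n A0l A0q.
(* The guard [A !=set0] lets the empty chain have its union, the empty set,
   in [P]. *)
pose P := [set A | [/\ lin_closed A, dominated A & A !=set0 -> A0 `<=` A]].
have [F FP Ft|A [[Al Aq AA0] Amax]] := @Zorn_bigcup (E * R^o)%type P.
  split.
  - move=> a u v [X FX Xu] [Y FY Yv].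
    have [XY|YX] := Ft _ _ FX FY.
      by exists Y => //; have [+ _ _] := FP _ FY; apply=> //; exact: XY.
    by exists X => //; have [+ _ _] := FP _ FX; apply=> //; exact: YX.
  - by move=> z [X /FP[_ + _]]; exact.
  - move=> [z [X FX Xz]]; have [_ _ h] := FP _ FX.
    by apply: subset_trans (h _) _; [exists z|exact: bigcup_sup].
have An : A !=set0.
  apply/set0P/eqP => Ae; apply: (Amax A0).
    by rewrite Ae; split=> [//|sub]; case: A0n => z /sub.
  by split=> // _; exact: subset_refl.
have {}AA0 := AA0 An.
have Adom x : exists r, A (x, r).
  have [c cq] := dominated_extension x Al Aq An.
  apply: contrapT => xA.
  apply: (Amax [set z | exists t : R, A (z - t *: (x, c : R^o))]).
    split; first by move=> z Az; exists 0; rewrite scale0r subr0.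
    move=> sub; apply: xA; exists c; apply: sub.
    by exists 1; rewrite scale1r subrr; case: An => z; exact: lin_closed0.
  split=> //.
    move=> a u v [t tu] [s sv]; exists (a * t + s).
    have := Al a _ _ tu sv.
    by rewrite scalerBr addrACA -opprD scalerA -scalerDl.
  by move=> _ z /AA0 Az; exists 0; rewrite scale0r subr0.
pose f x : R^o := projT1 (cid (Adom x)).
have Af x : A (x, f x) by rewrite /f; case: cid.
have flin : linear f.
  move=> a x y; apply: (dominated_functional Al Aq (Af _)).
  exact: (Al a _ _ (Af x) (Af y)).
pose F : {linear E -> R^o} := HB.pack f (GRing.isLinear.Build _ _ _ _ _ flin).
exists F => [[x r] /AA0 Axr|x]; last exact: (Aq _ (Af x)).
exact: (dominated_functional Al Aq (Af x) Axr).
Qed.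

End hahn_banach.

(** * Continuous linear functionals *)

Section dual_facts.
Context {R : realType}.

Lemma dual_of_bounded (E : normedModType R) (f : E -> R^o) (K : R) :
  linear f -> (forall x, `|f x| <= K * `|x|) ->
  exists g : dual E, forall x, g x = f x.
Proof.
move=> flin fK.
pose fL : {linear E -> R^o} := HB.pack f (GRing.isLinear.Build _ _ _ _ _ flin).
have cf : continuous fL.
  apply/linear_bounded_continuous/linear_boundedP; near=> r => x.
  by rewrite (le_trans (fK x))// ler_wpM2r//; near: r; exact: nbhs_pinfty_ge.
have fP : (f : E -> R^o) \in @dual_pred R E.
  by rewrite inE; split.
by exists (Dual fP).
Unshelve. all: by end_near. Qed.

Lemma hahn_banach_dual (E : normedModType R) (K : R) (A0 : set (E * R^o)) :
  0 <= K -> A0 !=set0 -> lin_closed A0 -> dominated (fun x => K * `|x|) A0 ->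
  exists2 g : dual E, forall z, A0 z -> g z.1 = z.2 & `|g| <= K.
Proof.
move=> K0 A0n A0l A0q.
have [||F FA FK] := @hahn_banach R E _ _ _ A0 A0n A0l A0q.
- by move=> x y; rewrite -mulrDr ler_wpM2l// ler_normD.
- by move=> a x a0; rewrite normrZ ger0_norm// mulrCA.
have FK' x : `|F x| <= K * `|x|.
  by rewrite ler_norml FK lerNl -linearN (le_trans (FK _))// normrN.
have [g gF] := dual_of_bounded (linearP F) FK'.
exists g => [z /FA <-//|]; apply: dual_norm_le => x x1.
by rewrite gF (le_trans (FK' x))// ler_piMr.
Qed.

Lemma norming_functional (E : normedModType R) (u : E) :
  exists2 g : dual E, `|g| <= 1 & g u = `|u|.
Proof.
have [||||g gu g1] := @hahn_banach_dual E 1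
  [set (a *: u, a * `|u| : R^o) | a in setT].
- by [].
- by exists (0 *: u, 0 * `|u| : R^o); exists 0.
- move=> a _ _ [b _ <-] [c _ <-]; exists (a * b + c) => //.
  by rewrite scalerDl mulrDl -scalerA -mulrA.
- by move=> _ [a _ <-] /=; rewrite mul1r normrZ ler_wpM2r// ler_norm.
exists g => //; have := gu (1 *: u, 1 * `|u|); rewrite /= scale1r mul1r; apply.
by exists 1 => //; rewrite scale1r mul1r.
Qed.

(** A ball of radius [r] around [x0] misses [V], so [t * r <= `|v + t *: x0|]
    for [v] in [V]: the functional [v + t *: x0 |-> t * r] is dominated by the
    norm. *)
Lemma separating_functional (E : normedModType R) (V : set E) (x0 : E) :
  submod_closed (mem V) -> closed V -> ~ V x0 ->
  exists2 g : dual E, forall v, V v -> g v = 0 & g x0 != 0.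
Proof.
move=> [V0 Vl] Vc x0V.
have [r r0 rV] : exists2 r : R, 0 < r & forall v, V v -> r <= `|x0 - v|.
  have /= : nbhs x0 (~` V).
    by apply: open_nbhs_nbhs; split=> //; exact: closed_openC.
  move=> /nbhs_ballP[r /= r0 rV]; exists r => // v Vv.
  by rewrite leNgt; apply/negP => xv; apply: (rV v) => //; rewrite -ball_normE.
have Vz a v : V v -> V (a *: v).
  by move=> Vv; have := Vl a v 0; rewrite !inE addr0; apply=> //; rewrite -inE.
have [||||g gV _] := @hahn_banach_dual E 1
  [set z | exists t : R, z.2 = t * r /\ V (z.1 - t *: x0)].
- by [].
- by exists 0; exists 0; rewrite mul0r scale0r subr0; split=> //; rewrite -inE.
- move=> a [u _] [v _] [t [/= -> tu]] [s [/= -> sv]]; exists (a * t + s).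
  split=> /=; first by rewrite mulrDl -mulrA.
  have := Vl a _ _ (mem_set tu) (mem_set sv).
  by rewrite inE scalerBr addrACA -opprD scalerA -scalerDl.
- move=> [x _] /= [t [-> tx]]; rewrite mul1r.
  have [t0|t0] := leP t 0.
    by rewrite (@le_trans _ _ 0)// mulr_le0_ge0// ltW.
  have := rV _ (Vz (- t^-1) _ tx).
  rewrite scalerBr scalerA mulNr mulVf ?gt_eqF// scaleN1r opprK.
  rewrite opprD addrCA subrr addr0 scaleNr opprK.
  by rewrite normrZ gtr0_norm ?invr_gt0// ler_pdivlMl.
exists g => [v Vv|].
  by rewrite (gV (v, 0))//; exists 0; rewrite mul0r scale0r subr0.
rewrite (gV (x0, r)) ?gt_eqF//; exists 1; rewrite mul1r scale1r subrr.
by split=> //; rewrite -inE.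
Qed.

End dual_facts.

(** * Completeness of the dual and uniform boundedness *)

Section dual_complete.
Context {R : realType} (E : normedModType R).

(** The pointwise limit is linear, and it is bounded and a limit in norm since
    the Cauchy estimate [`|g x - h x| <= e * `|x|] passes to the limit in [h]. *)
Lemma dual_cauchy_cvg (F : set_system (dual E)) :
  ProperFilter F -> cauchy F -> cvg F.
Proof.
move=> FF /(@cauchyP R) Fc.
have Fball e : 0 < e -> exists g : dual E, \forall h \near F, `|g - h| < e.
  by move=> /Fc[g Fg]; exists g; rewrite -ball_normE in Fg.
have cvgx x : cvg ((fun h : dual E => h x) @ F).
  apply: cauchy_cvg; apply/cauchy_exP => e e0.
  have x1 : 0 < `|x| + 1 by rewrite ltr_wpDl.
  have [g Fg] := Fball _ (divr_gt0 e0 x1).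
  exists (g x); rewrite -ball_normE.
  change (F [set h : dual E | `|g x - h x| < e]); near=> h => /=.
  rewrite (le_lt_trans (dual_normP (g - h) x))//.
  rewrite (@le_lt_trans _ _ (`|g - h| * (`|x| + 1)))//.
    by rewrite ler_wpM2l ?dual_norm_ge0// lerDl.
  by rewrite -ltr_pdivlMr//; near: h.
pose f x : R^o := lim ((fun h : dual E => h x) @ F).
have fcvg x : (fun h : dual E => h x) @ F --> f x by exact: cvgx.
have flin : linear f.
  move=> a x y; apply: (@cvg_unique _ _ _ _ _ _ (fcvg (a *: x + y))) => //.
  rewrite (_ : (fun h : dual E => h (a *: x + y)) =
               (fun h : dual E => a *: h x + h y)); last first.
    by apply/funext => h; rewrite linearP.
  by apply: cvgD; [apply: cvgZr; exact: fcvg|exact: fcvg].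
have fdist (g : dual E) e : (\forall h \near F, `|g - h| < e) ->
    forall x, `|g x - f x| <= e * `|x|.
  move=> Fg x.
  apply: (@closed_cvg _ _ F _ (fun h : dual E => `|g x - h x|)
    [set y | y <= e * `|x|]).
  - exact: closed_le.
  - near=> h => /=; rewrite (le_trans (dual_normP (g - h) x))//.
    by rewrite ler_wpM2r// ltW//; near: h.
  - by apply: cvg_norm; apply: cvgB; [exact: cvg_cst|exact: fcvg].
have [g1 Fg1] := Fball _ ltr01.
have [k kf] : exists k : dual E, forall x, k x = f x.
  apply: (@dual_of_bounded _ _ f (`|g1| + 1) flin) => x.
  rewrite -(subrKC (g1 x) (f x)) (le_trans (ler_normD _ _))// mulrDl.
  by rewrite lerD ?dual_normP// distrC fdist.
apply/cvg_ex; exists k; apply/fcvgrPdist_lt => e e0.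
have e2 : 0 < e / 2 by rewrite divr_gt0.
have [g Fg] := Fball _ e2; near=> h.
rewrite -(subrKA g) (le_lt_trans (ler_normD _ _))// [ltRHS]splitr ler_ltD//.
  apply: dual_norm_le => x x1.
  rewrite (_ : (k - g) x = f x - g x); last by rewrite -kf.
  by rewrite distrC (le_trans (fdist _ _ Fg x))// ler_piMr// ltW.
by near: h.
Unshelve. all: by end_near. Qed.

HB.instance Definition _ := Uniform_isComplete.Build (dual E) dual_cauchy_cvg.

End dual_complete.

(** The uniform boundedness principle on the dual of [E], for the evaluations at
    the points of [U]; a norming functional recovers [`|u|]. *)
Lemma weakly_bounded_bounded (R : realType) (E : normedModType R) (U : set E) :
  (forall f : dual E, exists M, forall u, U u -> `|f u| <= M) ->
  exists M, forall u, U u -> `|u| <= M.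
Proof.
move=> Uw.
have [||M BM] := @Banach_Steinhauss R (dual E) R^o
  [set (fun f : dual E => f u) | u in U] _ _ 1.
- move=> _ [u _ <-]; split=> [r|//].
  exists (r * `|u|) => f fr.
  by rewrite (le_trans (dual_normP f u))// ler_wpM2r.
- move=> f; have [M fM] := Uw f; exists M => _ [u Uu <-]; exact: fM.
exists M => u Uu; have [g g1 gu] := norming_functional u.
rewrite -[`|u|]normr_id -gu; exact: (BM _ (imageP _ Uu) g g1).
Qed.

(** One half of the bipolar theorem.  A functional on the dual that separates
    [mu] from [V] is, by reflexivity, the evaluation at a point of [E]. *)
Lemma dual_closed_annihilator (R : realType) (E : normedModType R)
    (V : set (dual E)) (mu : dual E) :
  reflexive_space E -> submod_closed (mem V) -> closed V ->
  (forall x, (forall nu, V nu -> nu x = 0) -> mu x = 0) -> V mu.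
Proof.
move=> Erefl Vs Vc mu0; apply: contrapT => muV.
have [phi phiV] := separating_functional Vs Vc muV.
have [x phix] := Erefl phi; rewrite phix mu0 ?eqxx// => nu Vnu.
by rewrite -phix phiV.
Qed.

(** * The seminorm defined by a subspace of the dual *)

Section seminorm_of_facts.
Context {R : realType} (E : normedModType R) (V : set (dual E)).

Lemma seminorm_of_bound mu u : V mu -> `|mu u| <= seminorm_of V u * `|mu|.
Proof.
move=> Vmu; have [->|mu0] := eqVneq mu 0.
  by rewrite [X in `|X|](_ : _ = 0)// !normr0 mulr0.
rewrite -ler_pdivrMr ?normr_gt0//.
apply: (ub_le_sup (seminorm_of_has_ubound V u)).
by exists mu => //; split=> //; exact/eqP.
Qed.

Lemma seminorm_of_le u c : 0 <= c ->
  (forall mu, V mu -> `|mu u| <= c * `|mu|) -> seminorm_of V u <= c.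
Proof.
move=> c0 uc; rewrite /seminorm_of; set S := image _ _.
have [->|/set0P S0] := eqVneq S set0; first by rewrite sup0.
apply: ge_sup => // _ [mu [Vmu /eqP mu0] <-].
by rewrite ler_pdivrMr ?normr_gt0// uc.
Qed.

Lemma seminorm_of_ge0 u : 0 <= seminorm_of V u.
Proof.
rewrite /seminorm_of; set S := image _ _.
have [->|/set0P[r Sr]] := eqVneq S set0; first by rewrite sup0.
apply: le_trans (ub_le_sup (seminorm_of_has_ubound V u) Sr).
by case: Sr => mu _ <-; rewrite divr_ge0.
Qed.

Lemma seminorm_of_le_norm u : seminorm_of V u <= `|u|.
Proof. by apply: seminorm_of_le => // mu _; rewrite mulrC dual_normP. Qed.

Lemma seminorm_ofD u v :
  seminorm_of V (u + v) <= seminorm_of V u + seminorm_of V v.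
Proof.
apply: seminorm_of_le => [|mu Vmu]; first by rewrite addr_ge0 ?seminorm_of_ge0.
rewrite linearD (le_trans (ler_normD _ _))// mulrDl.
by rewrite lerD ?seminorm_of_bound.
Qed.

Lemma seminorm_ofZ a u : 0 <= a ->
  seminorm_of V (a *: u) = a * seminorm_of V u.
Proof.
have le b w : 0 <= b -> seminorm_of V (b *: w) <= b * seminorm_of V w.
  move=> b0; apply: seminorm_of_le => [|mu Vmu].
    by rewrite mulr_ge0 ?seminorm_of_ge0.
  by rewrite linearZ normrZ ger0_norm// -mulrA ler_wpM2l// seminorm_of_bound.
rewrite le_eqVlt => /predU1P[<-|a0].
  apply/eqP; rewrite mul0r eq_le seminorm_of_ge0 andbT.
  by rewrite (le_trans (seminorm_of_le_norm _))// scale0r normr0.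
apply/eqP; rewrite eq_le (le _ _ (ltW a0))/= -ler_pdivlMl//.
have := le a^-1 (a *: u); rewrite scalerA mulVf ?gt_eqF// scale1r.
by apply; rewrite invr_ge0 ltW.
Qed.

Lemma seminorm_ofN u : seminorm_of V (- u) = seminorm_of V u.
Proof.
by congr sup; apply: eq_imagel => mu _; rewrite linearN normrN.
Qed.

End seminorm_of_facts.

(** * Comparison of the norms *)

Section lp_sum.
Context {R : realType} (p : R).
Hypothesis p1 : 1 < p.

Let p0 : 0 < p. Proof. exact: lt_trans p1. Qed.

Let powRK (x : R) : 0 <= x -> (x `^ p) `^ p^-1 = x.
Proof. by move=> x0; rewrite -powRrM divff ?gt_eqF// powRr1. Qed.

Lemma lp_sum_ge (a b : R) : 0 <= a -> 0 <= b ->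
  a <= (a `^ p + b `^ p) `^ p^-1.
Proof.
move=> a0 b0; rewrite -[leLHS]powRK//.
rewrite ge0_ler_powR ?nnegrE ?invr_ge0 ?addr_ge0 ?powR_ge0 ?(ltW p0)//.
by rewrite lerDl powR_ge0.
Qed.

Lemma lp_sum_le (a b c : R) : 0 <= a -> 0 <= b -> a <= c -> b <= c ->
  (a `^ p + b `^ p) `^ p^-1 <= 2 * c.
Proof.
move=> a0 b0 ac bc; have c0 := le_trans a0 ac.
have c20 : 0 <= 2 * c by rewrite mulr_ge0.
rewrite -[leRHS]powRK//.
rewrite ge0_ler_powR ?nnegrE ?invr_ge0 ?addr_ge0 ?powR_ge0 ?(ltW p0)//.
rewrite powRM// (@le_trans _ _ (2 * c `^ p))//.
  by rewrite mulr2n mulrDl !mul1r lerD// ge0_ler_powR ?nnegrE ?(ltW p0).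
have two_le : 2 <= 2 `^ p by rewrite le1r_powR ?ler1n ?(ltW p1).
by rewrite ler_wpM2r ?powR_ge0.
Qed.

End lp_sum.

Section graph_operator.
Context {R : realType} (L LL : normedModType R).
Variables (WG : set L) (G : L -> LL) (V : set (dual L)).

Definition coercive_on := exists2 K : R, 0 < K &
  forall u, WG u -> `|u| <= K * (seminorm_of V u + `|G u|).

(** For the converse direction, [normWG] dominates both of its terms, hence also
    [`|u|] up to the factor [K * 2]. *)
Lemma normWG_equiv_coercive (p : R) : 1 < p ->
  (exists2 C : R, 0 < C & forall u, WG u ->
    normWG_graph G p u <= C * normWG G p V u) <-> coercive_on.
Proof.
move=> p1; split=> [[C C0 CW]|[K K0 KW]].
  exists (C * 2); first by rewrite mulr_gt0.
  move=> u Wu; apply: le_trans (le_trans _ (CW u Wu)) _.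
    exact: lp_sum_ge.
  rewrite -mulrA ler_wpM2l ?(ltW C0)//.
  by apply: lp_sum_le => //; rewrite ?lerDl ?lerDr// seminorm_of_ge0.
exists (2 * (K * 2 + 1)) => [|u Wu].
  by rewrite mulr_gt0// addr_gt0// mulr_gt0.
set m := normWG G p V u; rewrite -mulrA.
have sm : seminorm_of V u <= m.
  by apply: lp_sum_ge => //; exact: seminorm_of_ge0.
have Gm : `|G u| <= m.
  by rewrite /m /normWG addrC; apply: lp_sum_ge => //; exact: seminorm_of_ge0.
have m0 : 0 <= m := le_trans (normr_ge0 _) Gm.
have K2m : 0 <= K * 2 * m by rewrite !mulr_ge0// ltW.
apply: lp_sum_le => //; rewrite mulrDl mul1r.
  rewrite (le_trans (KW u Wu))// ler_wpDr// -mulrA ler_wpM2l ?(ltW K0)//.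
  by rewrite mulr2n mulrDl !mul1r lerD.
by rewrite ler_wpDl.
Qed.

(** * Coercivity and the range of the dual operator *)

Hypotheses (WGs : submod_closed (mem WG)) (Gl : linear_on WG G).

Let WG0 : WG 0. Proof. by have [] := WGs; rewrite inE. Qed.

Let WGl a u v : WG u -> WG v -> WG (a *: u + v).
Proof.
by move=> Wu Wv; case: WGs => _ /(_ a _ _ (mem_set Wu) (mem_set Wv)); rewrite inE.
Qed.

Let G0 : G 0 = 0.
Proof.
have := Gl 1 WG0 WG0; rewrite !scale1r addr0 => /eqP.
by rewrite -subr_eq0 opprD addrA subrr sub0r oppr_eq0 => /eqP.
Qed.

(** The unit ball of the seminorm [u |-> seminorm_of V u + `|G u|] on [WG] is
    weakly bounded. *)
Lemma coercive_of_range_sum :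
  [set: dual L] = [set f + g | f in ImD WG G & g in V] -> coercive_on.
Proof.
move=> DV.
pose N u := seminorm_of V u + `|G u|.
have [f|M MU] := @weakly_bounded_bounded R L [set u | WG u /\ N u <= 1].
  have : [set: dual L] f by [].
  rewrite DV => -[_ [v vD <-] [mu Vmu <-]].
  exists (`|v| + `|mu|) => u [Wu Nu].
  have Du : Dop WG G v u = - v (G u).
    by apply/eqP; rewrite -addr_eq0 addrC; apply/eqP; exact: dual_rel_Dop.
  rewrite [X in `|X|](_ : _ = - v (G u) + mu u); last by rewrite -Du.
  have G1 : `|G u| <= 1 by rewrite (le_trans _ Nu)// lerDr seminorm_of_ge0.
  have s1 : seminorm_of V u <= 1 by rewrite (le_trans _ Nu)// lerDl.
  rewrite (le_trans (ler_normD _ _))// normrN lerD//.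
    by rewrite (le_trans (dual_normP v _))// ler_piMr ?dual_norm_ge0.
  by rewrite (le_trans (seminorm_of_bound _ Vmu))// ler_piMl.
(* Normalizing by [N u + e / K] rather than by [N u] covers the case [N u = 0];
   the error is then [K * (e / K) = e]. *)
pose K := `|M| + 1; have K0 : 0 < K by rewrite ltr_wpDl.
exists K => // u Wu; apply/ler_addgt0Pr => e e0.
have N0 : 0 <= N u by rewrite addr_ge0 ?seminorm_of_ge0.
have s0 : 0 < N u + e / K by rewrite ltr_wpDl// divr_gt0.
have si0 : 0 < (N u + e / K)^-1 by rewrite invr_gt0.
have := MU ((N u + e / K)^-1 *: u) _.
rewrite normrZ gtr0_norm// ler_pdivrMl// => h.
apply: (@le_trans _ _ ((N u + e / K) * K)).
  apply: (le_trans (h _)).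
    split; first by rewrite -[_ *: u]addr0; exact: WGl.
    rewrite /N -[_ *: u]addr0 Gl// G0 !addr0 seminorm_ofZ ?(ltW si0)//.
    rewrite normrZ gtr0_norm// -mulrDr ler_pdivrMl// mulr1 lerDl.
    by rewrite divr_ge0// ltW.
  by rewrite ler_wpM2l ?(ltW s0)// (le_trans (ler_norm M))// lerDl.
by rewrite mulrDl divfK ?gt_eqF// mulrC.
Qed.

(** Dominating the component on [L] by [seminorm_of V], and not only by the norm,
    is what forces it to vanish on the annihilator of [V]. *)
Lemma range_sum_of_coercive : reflexive_space L -> submod_closed (mem V) ->
  closed V -> dense WG -> coercive_on ->
  [set: dual L] = [set f + g | f in ImD WG G & g in V].
Proof.
move=> Lrefl Vs Vc WGd [K K0 KW]; apply/esym; rewrite -subTset => f _.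
pose c := `|f| * K; have c0 : 0 <= c by rewrite mulr_ge0// ltW.
pose q (z : L * LL) := c * (seminorm_of V z.1 + `|z.2|).
have [|||||F Ff Fq] := @hahn_banach R (L * LL)%type q _ _
  [set ((u, G u), f u : R^o) | u in WG].
- move=> x y; rewrite /q -mulrDr ler_wpM2l// addrACA.
  by rewrite lerD ?seminorm_ofD ?ler_normD.
- move=> a x a0; rewrite /q /= seminorm_ofZ// normrZ ger0_norm//.
  by rewrite -mulrDr mulrCA.
- by exists ((0, G 0), f 0); exists 0.
- move=> a _ _ [u Wu <-] [v Wv <-]; exists (a *: u + v); first exact: WGl.
  by rewrite Gl// linearP.
- move=> _ [u Wu <-] /=; rewrite /q /= (le_trans (ler_norm _))//.
  by rewrite (le_trans (dual_normP f u))// -mulrA ler_wpM2l ?dual_norm_ge0// KW.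
have Fabs z : `|F z| <= q z.
  rewrite ler_norml Fq lerNl -linearN (le_trans (Fq _))//.
  by rewrite /q /= normrN seminorm_ofN.
pose F1 x : R^o := F (x, 0); pose F2 y : R^o := - F (0, y).
have F1l : linear F1.
  by move=> a x y; rewrite -linearP; congr (F (_, _)); rewrite /= scaler0 addr0.
have F2l : linear F2.
  move=> a x y; rewrite scalerN -opprD -linearP.
  by congr (- F (_, _)); rewrite /= scaler0 addr0.
have F1V x : `|F1 x| <= c * seminorm_of V x.
  by rewrite (le_trans (Fabs _))// /q /= normr0 addr0.
have [mu muF] : exists mu : dual L, forall x, mu x = F1 x.
  apply: (@dual_of_bounded _ _ F1 c F1l) => x.
  by rewrite (le_trans (F1V x))// ler_wpM2l// seminorm_of_le_norm.
have [v vF] : exists v : dual LL, forall y, v y = F2 y.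
  apply: (@dual_of_bounded _ _ F2 c F2l) => y.
  rewrite normrN (le_trans (Fabs _))// /q /= ler_wpM2l// gerDr.
  by rewrite (le_trans (seminorm_of_le_norm _ _))// normr0.
have Vmu : V mu.
  apply: dual_closed_annihilator => // x Vx; apply/eqP; rewrite -normr_le0 muF.
  rewrite (le_trans (F1V x))// mulr_ge0_le0//.
  by apply: seminorm_of_le => // nu /Vx ->; rewrite normr0 mul0r.
have vrel : dual_rel WG G v (f - mu).
  move=> u Wu; rewrite [(f - mu) u](_ : _ = f u - mu u)// vF muF.
  have /= <- := Ff _ (imageP _ Wu).
  rewrite /F1 /F2 (_ : (u, G u) = (u, 0) + (0, G u)).
    by rewrite linearD [F (u, 0) + _]addrC addrK addNr.
  by congr pair; rewrite /= ?addr0 ?add0r.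
have vD : WD WG G v by exists (f - mu).
exists (f - mu).
  by exists v => //; apply: dual_rel_uniq WGd (dual_rel_Dop vD) vrel.
by exists mu => //; rewrite subrK.
Qed.

End graph_operator.

Theorem theorem3p2 (R : realType) (p : R) (L LL : completeNormedModType R)
  (WG : set L) (G : L -> LL) (V : set (dual L)) :
  1 < p ->
  separable L -> separable LL ->
  reflexive_space L -> reflexive_space LL ->
  submod_closed (mem WG) -> dense WG ->
  linear_on WG G -> closed (graph_on WG G) ->
  submod_closed (mem V) -> closed V ->
  [set: dual L] = [set f + g | f in ImD WG G & g in V] <->
  exists2 C : R, 0 < C & forall u, WG u ->
    normWG_graph G p u <= C * normWG G p V u.
Proof.
move=> p1 _ _ Lrefl _ WGs WGd Gl _ Vs Vc; rewrite normWG_equiv_coercive//.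
split; first exact: coercive_of_range_sum.
exact: range_sum_of_coercive.
Qed.
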